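(* Let $(U_{i,j})_{1\le i\le j}$ be an infinite triangular array of i.i.d. random variables with common law $\mathcal{L}$ supported on $[0,\infty)$ with mean $1$. Set $U_{j,i}=U_{i,j}$ and, for each $n\ge1$ and $1\le i\le n$, $\rho_i=\sum_{j=1}^nU_{i,j}$. Let $$\hat\rho=(\rho_1+\cdots+\rho_n)^{-1}(\rho_1\delta_1+\cdots+\rho_n\delta_n),\qquad \mathcal{U}=n^{-1}(\delta_1+\cdots+\delta_n),$$ which are probability measures on $\{1,\dots,n\}$. If $\mathcal{L}$ has finite second moment, then almost surely $$\lim_{n\to\infty}\|\hat\rho-\mathcal{U}\|_{\mathrm{TV}}=0.$$
   Context: The total variation distance between $\mu=\sum_{k=1}^n\mu_k\delta_k$ and $\nu=\sum_{k=1}^n\nu_k\delta_k$ on $\{1,\dots,n\}$ is $\|\mu-\nu\|_{\mathrm{TV}}=\frac12\sum_{k=1}^n|\mu_k-\nu_k|$. The measure $\hat\rho$ is the normalized reversible invariant probability measure of the Markov kernel $K_{i,j}=U_{i,j}/\rho_i$ on $\{1,\dots,n\}$. The quantities $\rho_i$, $\hat\rho$, $\mathcal U$ depend on $n$; $\hat\rho$ is defined almost surely for $n$ large enough, since then $\rho_1+\cdots+\rho_n>0$. *)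

(* Defs.v *)
From HB Require Import structures.
From mathcomp Require Import all_boot all_order all_algebra finmap.
From mathcomp Require Import all_classical all_reals all_analysis.

Set Implicit Arguments.
Unset Strict Implicit.
Unset Printing Implicit Defensive.

Import Order.TTheory GRing.Theory Num.Theory.
Import numFieldNormedType.Exports.

Local Open Scope classical_set_scope.
Local Open Scope ring_scope.

Definition mutually_independent (d : measure_display) (T : measurableType d)
    (R : realType) (P : probability T R) (I : choiceType) (D : set I)
    (X : I -> {RV P >-> R}) : Prop :=
  forall (J : {fset I}) (B : I -> set R),
    [set` J] `<=` D ->
    (forall i, i \in J -> measurable (B i)) ->
    P (\bigcap_(i in [set` J]) (X i @^-1` B i)) =
      (\prod_(i <- J) P (X i @^-1` B i))%E.

(* Measures are compared on Borel sets only: their values on other sets are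
   meaningless. *)
Definition iid_with_law (d : measure_display) (T : measurableType d)
    (R : realType) (P : probability T R) (L : probability R R)
    (I : choiceType) (D : set I) (X : I -> {RV P >-> R}) : Prop :=
  mutually_independent D X /\
  forall i, D i -> forall A : set R, measurable A -> distribution P (X i) A = L A.

(* The set {1, ..., n} is represented by 'I_n, and indices are shifted by one
   accordingly. *)

(* The triangular array is given by the entries U i j with i <= j; the other
   values of U are never used. *)
Definition triangular_indices : set (nat * nat) :=
  [set ij | (ij.1 <= ij.2)%N].

Definition symmetrize (A : Type) (U : nat -> nat -> A) (i j : nat) : A :=
  if (i <= j)%N then U i j else U j i.

Section Weights.
Variables (R : realFieldType) (n : nat).

Definition row_sum (u : nat -> nat -> R) (i : 'I_n) : R :=
  \sum_(j < n) u i j.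

(* A measure mu_1 \delta_1 + ... + mu_n \delta_n is represented by its vector of
   weights. *)
Definition tv_dist (mu nu : 'I_n -> R) : R :=
  2^-1 * \sum_(k < n) `|mu k - nu k|.

Definition uniform_weights : 'I_n -> R := fun=> n%:R^-1.

(* If all the row sums add up to 0, inversion at 0 makes this the zero vector,
   which for n > 0 is at distance 1 / 2 from uniform_weights: see
   tv_dist_degenerate. *)
Definition rho_hat (u : nat -> nat -> R) : 'I_n -> R :=
  fun i => (\sum_(k < n) row_sum u k)^-1 * row_sum u i.

Lemma sum_rho_hat (u : nat -> nat -> R) :
  \sum_(k < n) row_sum u k != 0 -> \sum_(i < n) rho_hat u i = 1.
Proof. by move=> s0; rewrite -mulr_sumr mulVf. Qed.

Lemma rho_hat_ge0 (u : nat -> nat -> R) (i : 'I_n) :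
  (forall j k, 0 <= u j k) -> 0 <= rho_hat u i.
Proof.
move=> u0; apply: mulr_ge0; last exact: sumr_ge0.
by rewrite invr_ge0; apply: sumr_ge0 => k _; exact: sumr_ge0.
Qed.

Lemma tv_dist_degenerate (u : nat -> nat -> R) :
  (0 < n)%N -> \sum_(k < n) row_sum u k = 0 ->
  tv_dist (rho_hat u) uniform_weights = 2^-1.
Proof.
move=> n0 s0; rewrite /tv_dist /rho_hat s0.
under eq_bigr do rewrite invr0 mul0r sub0r normrN ger0_norm ?invr_ge0 ?ler0n//.
by rewrite sumr_const card_ord -[_^-1 *+ _]mulr_natr mulVf ?mulr1// pnatr_eq0 -lt0n.
Qed.

End Weights.

(* Main.v *)
Require Import Defs.
From HB Require Import structures.
From mathcomp Require Import all_boot all_order all_algebra finmap.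
From mathcomp Require Import all_classical all_reals all_analysis.
From mathcomp Require Import measurable_realfun ring lra zify.

Set Implicit Arguments.
Unset Strict Implicit.
Unset Printing Implicit Defensive.

Import Order.TTheory GRing.Theory Num.Theory.
Import numFieldNormedType.Exports.

Local Open Scope classical_set_scope.
Local Open Scope ring_scope.

(** Let S_n = sum_(i < n) |rho_i - n| be the total deviation of the row sums
    (row_dev below) and T_n = sum_(i < n) rho_i the sum of all the entries.  As
    T_n - n^2 is the sum of the rho_i - n, it is at most S_n in absolute value,
    and the total variation distance is then at most 2 S_n / n^2 once
    S_n / n^2 <= 1/2 (tv_dist_row_dev).  So it is enough that S_n / n^2 tends
    to 0 almost surely.

    Two entries in the same row are at distinct positions of the triangle,
    hence independent, so rho_i - n is a sum of n orthogonal centered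
    variables and has second moment n s, where s is the variance of the law.
    By Cauchy-Schwarz, (S_n / n^2)^2 is at most n^-3 sum_i (rho_i - n)^2, whose
    expectation is s / n.  These bounds are not summable in n, but they are
    along the squares n = (k + 1)^2, and there S_n / n^2 tends to 0 almost
    surely because a series of nonnegative functions with summable integrals
    converges almost everywhere (ae_row_dev_cvg_squares).

    The other n are handled by monotonicity.  Since the entries are
    nonnegative, T_n grows with n, and S_n grows at most as fast as T_n + n^2
    (row_dev_sub_nonincreasing).  As T_n itself is within S_n of n^2, the
    deviation at n is controlled by the deviations at the two neighbouring
    squares m <= n <= p, up to an error 2 (p^2 - m^2) which is negligible
    because p / m tends to 1 (row_dev_cvg). *)

(** * Row deviations of a nonnegative array *)

Section RowDeviation.
Variable R : realType.
Implicit Types u : nat -> nat -> R.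

Definition entry_sum u n : R := \sum_(i < n) row_sum u i.

Definition row_dev u n : R := \sum_(i < n) `|row_sum u i - n%:R|.

Lemma row_dev_ge0 u n : 0 <= row_dev u n.
Proof. exact: sumr_ge0. Qed.

Lemma sum_row_excess u n :
  \sum_(i < n) (row_sum u i - n%:R) = entry_sum u n - n%:R ^+ 2.
Proof.
by rewrite big_split/= sumrN sumr_const card_ord -[n%:R *+ n]mulr_natr -expr2.
Qed.

Lemma entry_sum_row_dev u n : `|entry_sum u n - n%:R ^+ 2| <= row_dev u n.
Proof. by rewrite -sum_row_excess; exact: ler_norm_sum. Qed.

Lemma entry_sum_nondecreasing u : (forall i j, 0 <= u i j) ->
  nondecreasing_seq (entry_sum u).
Proof.
move=> u0; apply/nondecreasing_seqP => n.
rewrite /entry_sum big_ord_recr/= -[leLHS]addr0 lerD ?sumr_ge0//.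
by apply: ler_sum => i _; rewrite /row_sum big_ord_recr/= lerDl.
Qed.

(** Enlarging the array by a row and a column of nonnegative entries changes
    each |rho_i - n| by at most the sum of the |u_ij - 1| <= u_ij + 1 over the
    new entries of row i, while entry_sum + n ^ 2 grows by exactly the sum of
    these bounds. *)
Lemma row_dev_sub_nonincreasing u : (forall i j, 0 <= u i j) ->
  nonincreasing_seq (fun n => row_dev u n - entry_sum u n - n%:R ^+ 2).
Proof.
move=> u0; apply/nonincreasing_seqP => n.
have E k : row_dev u k - entry_sum u k - k%:R ^+ 2 =
    \sum_(i < k) (`|row_sum u i - k%:R| - row_sum u i - k%:R).
  by rewrite !big_split/= !sumrN sumr_const card_ord -[k%:R *+ k]mulr_natr -expr2.
rewrite !E big_ord_recr/= -[leRHS]addr0 lerD//.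
  apply: ler_sum => i _.
  have -> : row_sum u (widen_ord (leqnSn n) i) = row_sum u i + u i n.
    by rewrite /row_sum big_ord_recr.
  rewrite -natr1.
  have := ler_normD (row_sum u i - n%:R) (u i n - 1).
  have : `|u i n - 1| <= u i n + 1.
    by rewrite ler_norml; have := u0 i n; lra.
  rewrite [_ + (u i n - 1)](_ : _ = row_sum u i + u i n - (n%:R + 1)); last by ring.
  lra.
have : 0 <= row_sum u (@ord_max n) by exact: sumr_ge0.
have : 0 <= n.+1%:R :> R by [].
set a := row_sum _ _; set b := n.+1%:R => b0 a0.
have : `|a - b| <= a + b by rewrite ler_norml; lra.
lra.
Qed.

(** The growth of row_dev between m and n is at most that of
    entry_sum + n ^ 2, and entry_sum is controlled at both m and p by its
    distance row_dev to the square. *)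
Lemma row_dev_sandwich u m n p : (forall i j, 0 <= u i j) ->
  (m <= n <= p)%N ->
  row_dev u n <= 2 * row_dev u m + row_dev u p + 2 * (p%:R ^+ 2 - m%:R ^+ 2).
Proof.
move=> u0 /andP[mn np].
have := row_dev_sub_nonincreasing u0 mn.
have := entry_sum_nondecreasing u0 np.
have := entry_sum_row_dev u m; have := entry_sum_row_dev u p.
have : n%:R ^+ 2 <= p%:R ^+ 2 :> R by rewrite lerXn2r ?nnegrE// ler_nat.
rewrite !ler_norml; lra.
Qed.

Lemma between_squares n : (0 < n)%N -> exists k, (k.+1 ^ 2 <= n <= k.+2 ^ 2)%N.
Proof.
elim: n => // -[_ _|n /(_ isT)[k /andP[kn nk]] _]; first by exists 0%N.
have [nk'|nk'] := leqP n.+2 (k.+2 ^ 2); first by exists k; rewrite nk' (leq_trans kn).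
by exists k.+1; apply/andP; split; [exact: ltnW|nia].
Qed.

(** Convergence along the squares suffices: consecutive squares have ratio
    tending to 1, so row_dev_sandwich loses only a vanishing error. *)
Lemma row_dev_cvg u : (forall i j, 0 <= u i j) ->
  row_dev u (k.+1 ^ 2)%N / ((k.+1 ^ 2)%N%:R ^+ 2) @[k --> \oo] --> (0 : R) ->
  row_dev u n / n%:R ^+ 2 @[n --> \oo] --> (0 : R).
Proof.
move=> u0; set e := fun k : nat => _ => e0.
(* r k is the square of p / m for the consecutive squares m = (k + 1)^2 and
   p = (k + 2)^2, since (k + 2) / (k + 1) = s k. *)
pose s (k : nat) : R := 1 + harmonic k.
have s1 : s k @[k --> \oo] --> (1 : R).
  rewrite -[X in _ --> X]addr0.
  by apply: cvgD; [exact: cvg_cst|exact: cvg_harmonic].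
pose r k := s k * s k * (s k * s k).
have r1 : r k @[k --> \oo] --> (1 : R).
  have -> : (1 : R) = 1 * 1 * (1 * 1) by rewrite !mulr1.
  by do 2! apply: cvgM => //; apply: cvgM.
pose b k := 2 * e k + e k.+1 * r k + 2 * (r k - 1).
have b0 : b k @[k --> \oo] --> (0 : R).
  have -> : (0 : R) = 2 * 0 + 0 * 1 + 2 * (1 - 1) by ring.
  apply: cvgD; first apply: cvgD.
  - by apply: cvgM => //; exact: cvg_cst.
  - by apply: cvgM => //; rewrite cvg_shiftS.
  - by apply: cvgM; [exact: cvg_cst|apply: cvgB => //; exact: cvg_cst].
have eb k n : (k.+1 ^ 2 <= n <= k.+2 ^ 2)%N -> row_dev u n / n%:R ^+ 2 <= b k.
  move=> kn; have /andP[kn1 _] := kn.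
  have m0 : 0 < (k.+1 ^ 2)%N%:R :> R by rewrite ltr0n expn_gt0.
  have n0 : 0 < n%:R :> R by rewrite (lt_le_trans m0)// ler_nat.
  have mn : (k.+1 ^ 2)%N%:R ^+ 2 <= n%:R ^+ 2 :> R.
    by rewrite lerXn2r ?nnegrE ?ler_nat// ltW.
  apply: (@le_trans _ _ (row_dev u n / (k.+1 ^ 2)%N%:R ^+ 2)).
    by rewrite ler_wpM2l ?row_dev_ge0// lef_pV2 ?posrE ?exprn_gt0.
  rewrite ler_pdivrMr ?exprn_gt0//.
  apply: le_trans (row_dev_sandwich u0 kn) _.
  rewrite le_eqVlt; apply/orP; left; apply/eqP.
  rewrite /b /e /r /s /harmonic/=.
  rewrite !natrX -(natr1 k.+1).
  by field; rewrite !nat1r !natr1 !pnatr_eq0.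
apply/cvgrPdist_le => eps eps0.
have /cvgrPdist_le/(_ _ eps0)[K _ KP] := b0.
exists (K.+2 ^ 2)%N => // n/= Kn.
have [k kn] : exists k, (k.+1 ^ 2 <= n <= k.+2 ^ 2)%N by apply: between_squares; nia.
have Kk : (K <= k)%N by nia.
have := KP k Kk; rewrite /= !sub0r !normrN.
rewrite [in X in _ -> X]ger0_norm ?divr_ge0 ?row_dev_ge0 ?exprn_ge0// => h.
exact: le_trans (le_trans (eb _ _ kn) (ler_norm _)) h.
Qed.

(** With T the sum of all entries, T (rho_i / T - 1 / n) equals
    (rho_i - n) - (T - n^2) / n; summing over i bounds the l1 distance by
    2 row_dev / T, and T >= n^2 / 2 because row_dev <= n^2 / 2. *)
Lemma tv_dist_row_dev u n : (0 < n)%N -> row_dev u n / n%:R ^+ 2 <= 2^-1 ->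
  tv_dist (@rho_hat R n u) (@uniform_weights R n) <=
  2 * (row_dev u n / n%:R ^+ 2).
Proof.
move=> n0; set a := row_dev u n / _ => a2.
have N0 : 0 < n%:R :> R by rewrite ltr0n.
have aE : row_dev u n = a * n%:R ^+ 2 by rewrite /a divfK// expf_neq0 ?gt_eqF.
have := entry_sum_row_dev u n; rewrite aE => Tn.
have n20 : 0 < n%:R ^+ 2 :> R by rewrite exprn_gt0.
have T2 : n%:R ^+ 2 / 2 <= entry_sum u n.
  by move: Tn; rewrite ler_norml => /andP[+ _]; nra.
have T0 : 0 < entry_sum u n by apply: lt_le_trans T2; rewrite divr_gt0.
have bound (i : 'I_n) : `|rho_hat u i - uniform_weights R i| <=
    (entry_sum u n)^-1 *
      (`|row_sum u i - n%:R| + n%:R^-1 * `|entry_sum u n - n%:R ^+ 2|).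
  have -> : rho_hat u i - uniform_weights R i =
    (entry_sum u n)^-1 *
      ((row_sum u i - n%:R) - n%:R^-1 * (entry_sum u n - n%:R ^+ 2)).
    rewrite /rho_hat -/(entry_sum u n) /uniform_weights.
    by field; rewrite !gt_eqF.
  rewrite normrM gtr0_norm ?invr_gt0// ler_pM2l ?invr_gt0//.
  by rewrite (le_trans (ler_normB _ _))// normrM (@gtr0_norm _ n%:R^-1) ?invr_gt0.
have : \sum_(i < n) `|rho_hat u i - uniform_weights R i| <=
    (entry_sum u n)^-1 * (2 * row_dev u n).
  apply: le_trans (ler_sum _ (fun i _ => bound i)) _.
  rewrite -mulr_sumr ler_pM2l ?invr_gt0// big_split/= sumr_const card_ord.
  rewrite -[(_ * _) *+ n]mulr_natl mulrA mulfV ?gt_eqF// mul1r -/(row_dev u n).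
  by have := entry_sum_row_dev u n; lra.
rewrite /tv_dist => H.
have a0 : 0 <= a by rewrite divr_ge0 ?row_dev_ge0.
have : (entry_sum u n)^-1 * (2 * row_dev u n) <= 4 * a.
  by rewrite ler_pdivrMl// aE; nra.
lra.
Qed.

Lemma tv_dist_cvg u : row_dev u n / n%:R ^+ 2 @[n --> \oo] --> (0 : R) ->
  tv_dist (@rho_hat R n u) (@uniform_weights R n) @[n --> \oo] --> (0 : R).
Proof.
move=> h; apply: (@squeeze_cvgr _ _ _ _ (cst 0) (fun n => 2 * (row_dev u n / n%:R ^+ 2))).
- near=> n; apply/andP; split.
    by rewrite mulr_ge0 ?invr_ge0// sumr_ge0.
  apply: tv_dist_row_dev; first by near: n; exists 1%N.
  near: n; move/cvgrPdist_le : h => /(_ 2^-1); rewrite invr_gt0 ltr0n => /(_ isT).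
  by apply: filterS => n; rewrite sub0r normrN ger0_norm// divr_ge0 ?row_dev_ge0.
- exact: cvg_cst.
- by rewrite -[X in _ --> X](mulr0 2); apply: cvgM => //; exact: cvg_cst.
Unshelve. all: by end_near. Qed.

End RowDeviation.

(** * Second moments of sums of independent variables *)

Section Independence.
Context d (T : measurableType d) (R : realType) (P : probability T R).

(** Independence says that the joint law of X and Y is the product of their
    laws, so this is Fubini's theorem for the function f(x) g(y). *)
Lemma integral_prod_indep (X Y : {RV P >-> R}) (f g : R -> R) :
  (forall A B, measurable A -> measurable B ->
    P (X @^-1` A `&` Y @^-1` B) = (P (X @^-1` A) * P (Y @^-1` B))%E) ->
  measurable_fun [set: R] f -> measurable_fun [set: R] g ->
  P.-integrable [set: T] (fun w => (f (X w))%:E) ->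
  P.-integrable [set: T] (fun w => (g (Y w))%:E) ->
  P.-integrable [set: T] (fun w => (f (X w) * g (Y w))%:E) /\
  (\int[P]_w (f (X w) * g (Y w))%:E =
    \int[P]_w (f (X w))%:E * \int[P]_w (g (Y w))%:E)%E.
Proof.
move=> XY mf mg iX iY.
pose muX := distribution P X; pose muY := distribution P Y.
pose Z w := (X w, Y w); pose h (z : R * R) := (f z.1 * g z.2)%:E.
have mZ : measurable_fun [set: T] Z by exact: measurable_fun_pair.
have mef : measurable_fun [set: R] (fun x => (f x)%:E) by exact/measurable_EFinP.
have meg : measurable_fun [set: R] (fun x => (g x)%:E) by exact/measurable_EFinP.
have mh : measurable_fun [set: R * R] h.
  apply/measurable_EFinP; apply: measurable_funM.
    exact: measurableT_comp mf (@measurable_fst _ _ _ _).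
  exact: measurableT_comp mg (@measurable_snd _ _ _ _).
have joint A : measurable A -> (muX \x muY)%E A = pushforward P Z A.
  by move=> mA; apply: product_measure_unique mA => // B C mB mC; exact: XY.
have if_ : muX.-integrable [set: R] (fun x => (f x)%:E) by exact: integrable_pushforward.
have ig : muY.-integrable [set: R] (fun x => (g x)%:E) by exact: integrable_pushforward.
have ih : (muX \x muY)%E.-integrable [set: R * R] h.
  apply/integrable12ltyP => //=.
  have mag : measurable_fun [set: R] (fun y => `|(g y)%:E|%E).
    exact: measurableT_comp (@abse_measurable R setT) meg.
  have maf : measurable_fun [set: R] (fun x => `|(f x)%:E|%E).
    exact: measurableT_comp (@abse_measurable R setT) mef.
  rewrite (eq_integral (fun x => `|(f x)%:E| * \int[muY]_y `|(g y)%:E|)%E); last first.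
    move=> x _; rewrite -ge0_integralZl//.
    by apply: eq_integral => y _; rewrite -abseM.
  rewrite ge0_integralZr//=; last exact: integral_ge0.
  move/integrableP : if_ => [_ +]; move/integrableP : ig => [_ +].
  move=> gy fy; rewrite lte_mul_pinfty//.
  - exact: integral_ge0.
  - by rewrite ge0_fin_numE//; exact: integral_ge0.
have ihZ : P.-integrable [set: T] (h \o Z).
  apply/integrableP; split; first exact: measurableT_comp.
  move/integrableP : ih => [_]; apply: le_lt_trans.
  rewrite (eq_measure_integral (pushforward P Z)); last by move=> A mA _; exact: joint.
  by rewrite ge0_integral_pushforward//; exact: measurableT_comp.
split; first exact: ihZ.
transitivity (\int[pushforward P Z]_z h z)%E.
  by rewrite integral_pushforward.
rewrite -(@eq_measure_integral _ _ _ _ (pushforward P Z) (muX \x muY)%E); last first.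
  by move=> A mA _; exact: joint.
rewrite -integral12_prod_meas1// /fubini_F /h/=.
under eq_integral => x _.
  under eq_integral do rewrite EFinM.
  rewrite integralZl//.
  over.
rewrite /= -(fineK (integrable_fin_num measurableT ig)) integralZr//.
rewrite fineK ?(integrable_fin_num measurableT ig)//.
by rewrite !integral_distribution.
Qed.

End Independence.

Section Law.
Context d (T : measurableType d) (R : realType) (mu : {measure set T -> \bar R}).

(** Laws are compared on Borel sets only; this is enough because integrals
    do not depend on the values of a measure elsewhere. *)
Lemma integral_of_law (L : {measure set R -> \bar R}) (X : {mfun T >-> R})
    (f : R -> R) :
  (forall A, measurable A -> pushforward mu X A = L A) ->
  measurable_fun [set: R] f -> L.-integrable [set: R] (fun x : R => (f x)%:E) ->
  mu.-integrable [set: T] (fun w => (f (X w))%:E) /\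
  (\int[mu]_w (f (X w))%:E = \int[L]_x (f x)%:E)%E.
Proof.
move=> XL mf iL.
have mef : measurable_fun [set: R] (fun x => (f x)%:E) by exact/measurable_EFinP.
have iX : mu.-integrable [set: T] (fun w => (f (X w))%:E).
  apply/integrableP; split; first exact: measurableT_comp mef _.
  move/integrableP : iL => [_]; apply: le_lt_trans.
  rewrite -(@eq_measure_integral _ _ _ _ L (pushforward mu X)); last first.
    by move=> A mA _; exact: XL.
  rewrite [leRHS]ge0_integral_pushforward//.
  exact: measurableT_comp (@abse_measurable R setT) mef.
split=> //.
rewrite -(@eq_measure_integral _ _ _ _ L (pushforward mu X)); last first.
  by move=> A mA _; exact: XL.
by rewrite [RHS]integral_pushforward.
Qed.

End Law.

Section Orthogonal.
Context d (T : measurableType d) (R : realType) (mu : {measure set T -> \bar R}).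

(** Pythagoras: expanding the square leaves only the diagonal terms. *)
Lemma integral_sum_sqr_orthogonal (Z : nat -> T -> R) (s : R) n :
  (forall j k, mu.-integrable [set: T] (fun w => (Z j w * Z k w)%:E)) ->
  (forall j k, \int[mu]_w (Z j w * Z k w)%:E = (if j == k then s else 0)%:E)%E ->
  (\int[mu]_w ((\sum_(j < n) Z j w) ^+ 2)%:E = (n%:R * s)%:E)%E.
Proof.
move=> iZ EZ.
transitivity (\int[mu]_w \sum_(j < n) \sum_(k < n) (Z j w * Z k w)%:E)%E.
  apply: eq_integral => w _; rewrite expr2 mulr_suml -sumEFin.
  by apply: eq_bigr => j _; rewrite mulr_sumr -sumEFin.
rewrite integral_sum//; last by move=> j; exact: integrable_sum.
transitivity (\sum_(j < n) s%:E)%E.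
  apply: eq_bigr => j _; rewrite integral_sum//.
  rewrite (bigD1 j)//= EZ eqxx big1 ?adde0// => k kj.
  by rewrite EZ; case: eqP => // jk; rewrite (val_inj jk) eqxx in kj.
by rewrite sumEFin sumr_const card_ord mulr_natl.
Qed.

End Orthogonal.

(** * Almost sure convergence from summable integrals *)

Section SummableIntegrals.
Context d (T : measurableType d) (R : realType) (mu : {measure set T -> \bar R}).

(** The sum of the series is integrable, hence finite almost everywhere, and
    the terms of a convergent series tend to 0. *)
Lemma ae_cvg0_summable_integral (f : nat -> T -> R) :
  (forall k, measurable_fun [set: T] (f k)) ->
  (forall k w, 0 <= f k w) ->
  (\sum_(0 <= k <oo) \int[mu]_w (f k w)%:E < +oo)%E ->
  {ae mu, forall w, f k w @[k --> \oo] --> (0 : R)}.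
Proof.
move=> mf f0 foo.
have mef k : measurable_fun [set: T] (fun w => (f k w)%:E) by exact/measurable_EFinP.
have f0' k w : (0 <= (f k w)%:E)%E by rewrite lee_fin.
pose S w := (\sum_(0 <= k <oo) (f k w)%:E)%E.
have iS : mu.-integrable [set: T] S.
  apply/integrableP; split; first exact: ge0_emeasurable_sum.
  rewrite (eq_integral S) => [|w _]; last by rewrite gee0_abs// nneseries_ge0.
  by rewrite integral_nneseries.
have := integrable_ae measurableT iS; apply: filterS => w /(_ I) Sw.
have Soo : (S w < +oo)%E by rewrite ltey_eq Sw.
have tail0 := nneseries_tail_cvg Soo (fun k _ => f0' k w).
suff : (f k w)%:E @[k --> \oo] --> 0%E by move/fine_cvg.
apply: (squeeze_cvge _ (cvg_cst 0%E) tail0); apply: nearW => k.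
by rewrite f0'/= (nneseries_split k 1)// addn1 big_nat1 leeDl// nneseries_ge0.
Qed.

End SummableIntegrals.

Lemma nneseries_inv_sqr_lty (R : realType) (s : R) : 0 <= s ->
  (\sum_(0 <= k <oo) (s / k.+1%:R ^+ 2)%:E < +oo)%E.
Proof.
move=> s0.
(* 1 / (k + 1)^2 is at most 2 / (k + 1) - 2 / (k + 2), which telescopes. *)
have H n : \sum_(0 <= k < n) s / k.+1%:R ^+ 2 <= s * (2 - 2 / n.+1%:R).
  elim: n => [|n ih]; first by rewrite big_geq// divr1 subrr mulr0.
  rewrite big_nat_recr//=; apply: le_trans (lerD ih (lexx _)) _.
  rewrite -mulrDr ler_wpM2l// -(natr1 n.+1).
  have : 1 <= n.+1%:R :> R by rewrite ler1n.
  set x := n.+1%:R => x1; rewrite -subr_ge0.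
  have -> : 2 - 2 / (x + 1) - (2 - 2 / x + (x ^+ 2)^-1) =
      (x - 1) / (x ^+ 2 * (x + 1)).
    by field; apply/andP; split; lra.
  by rewrite divr_ge0 ?subr_ge0// mulr_ge0 ?sqr_ge0//; lra.
apply: (@le_lt_trans _ _ (s * 2)%:E); last exact: ltry.
apply: lime_le.
  by apply: is_cvg_nneseries => k _ _; rewrite lee_fin divr_ge0 ?sqr_ge0.
apply: nearW => n; rewrite sumEFin lee_fin (le_trans (H n))// ler_wpM2l//.
by rewrite gerBl divr_ge0.
Qed.

(** This case of the Cauchy-Schwarz inequality says that n times the variance
    of the a_i is nonnegative: expand the sum of the (n a_i - S)^2. *)
Lemma sqr_sum_le (R : realFieldType) n (a : 'I_n -> R) :
  (\sum_(i < n) a i) ^+ 2 <= n%:R * \sum_(i < n) a i ^+ 2.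
Proof.
case: n a => [a|n a]; first by rewrite !big_ord0 expr0n mulr0.
set S := \sum_(i < _) a i; set Q := \sum_(i < _) _.
have : 0 <= \sum_(i < n.+1) (n.+1%:R * a i - S) ^+ 2.
  by apply: sumr_ge0 => i _; exact: sqr_ge0.
have -> : \sum_(i < n.+1) (n.+1%:R * a i - S) ^+ 2 = n.+1%:R * (n.+1%:R * Q - S ^+ 2).
  rewrite (eq_bigr (fun i => n.+1%:R ^+ 2 * a i ^+ 2 - 2 * n.+1%:R * S * a i
    + S ^+ 2)); last by move=> i _; ring.
  rewrite big_split/= sumr_const card_ord -[S ^+ 2 *+ _]mulr_natl.
  rewrite sumrB -!mulr_sumr -/S -/Q.
  ring.
by rewrite pmulr_rge0 ?ltr0n// subr_ge0.
Qed.

(** * The random array *)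

Section TriangularArray.
Context d (T : measurableType d) (R : realType) (P : probability T R).
Variables (L : probability R R) (U : nat -> nat -> {RV P >-> R}).
Hypothesis U_iid : iid_with_law L triangular_indices
  (fun ij : nat * nat => U ij.1 ij.2).
Hypothesis L_supp : L `[0, +oo[%classic = 1%E.
Hypothesis L_mean : (\int[L]_x x%:E = 1)%E.
Hypothesis L_moment2 : (\int[L]_x (x ^+ 2)%:E < +oo)%E.

Let V i j := symmetrize U i j.

(** Position in the triangle of the variable that symmetrize puts in cell
    (i, j).  For a fixed row i it is injective in j: this is where the
    independence of the entries of one row comes from. *)
Let edge (i j : nat) := if (i <= j)%N then (i, j) else (j, i).

Let V_edge i j : V i j = U (edge i j).1 (edge i j).2.
Proof. by rewrite /V /symmetrize /edge; case: ifP. Qed.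

Let edge_triangular i j : triangular_indices (edge i j).
Proof. by rewrite /edge /triangular_indices/=; case: (leqP i j) => //= /ltnW. Qed.

Let edge_inj i : injective (edge i).
Proof.
by move=> j k; rewrite /edge; case: leqP => ij; case: leqP => ik E; case: E; lia.
Qed.

Let V_law i j A : measurable A -> pushforward P (V i j) A = L A.
Proof. by move=> mA; rewrite V_edge; exact: (U_iid.2 _ (edge_triangular i j) _ mA). Qed.

Let V_indep i j k : j != k -> forall A B, measurable A -> measurable B ->
  P (V i j @^-1` A `&` V i k @^-1` B) =
    (P (V i j @^-1` A) * P (V i k @^-1` B))%E.
Proof.
move=> jk A B mA mB.
have ek : (edge i k == edge i j) = false.
  by apply/negbTE; apply: contra jk => /eqP /edge_inj ->.
pose J := [fset edge i j; edge i k]%fset.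
pose C e := if e == edge i j then A else B.
have Cj : C (edge i j) = A by rewrite /C eqxx.
have Ck : C (edge i k) = B by rewrite /C ek.
have := U_iid.1 J C; rewrite /J big_fsetU1 ?inE 1?eq_sym ?ek//= big_seq_fset1.
rewrite Cj Ck -!V_edge => <-.
- congr (P _); rewrite predeqE => w; split=> [[Aw Bw] e/=|H].
    by rewrite !inE => /orP[] /eqP ->; rewrite ?Cj ?Ck -V_edge.
  split; rewrite V_edge.
    by rewrite -Cj; apply: H; rewrite /= !inE eqxx.
  by rewrite -Ck; apply: H; rewrite /= !inE eqxx orbT.
- by move=> e/=; rewrite !inE => /orP[] /eqP ->; exact: edge_triangular.
- by move=> e _; rewrite /C; case: ifP.
Qed.

Let integrable_sqr : L.-integrable [set: R] (fun x : R => (x ^+ 2)%:E).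
Proof.
apply/integrableP; split; first exact/measurable_EFinP/measurable_funX.
rewrite (eq_integral (fun x : R => (x ^+ 2)%:E))// => x _.
by rewrite gee0_abs// lee_fin sqr_ge0.
Qed.

(** |x| <= 1 + x^2. *)
Let integrable_id : L.-integrable [set: R] (fun x : R => x%:E).
Proof.
apply: (@le_integrable _ _ _ _ _ _ _ (fun x : R => (1 + x ^+ 2)%:E)) => //.
- exact/measurable_EFinP.
- move=> x _; rewrite !abse_EFin lee_fin ler_norml.
  by have := sqr_ge0 x; have := ler_norm (1 + x ^+ 2); nra.
- under eq_fun do rewrite EFinD.
  apply: integrableD => //; exact: finite_measure_integrable_cst.
Qed.

Let mcenter : measurable_fun [set: R] (fun x : R => x - 1).
Proof. exact: measurable_funB. Qed.

Let integrable_center : L.-integrable [set: R] (fun x : R => (x - 1)%:E).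
Proof.
under eq_fun do rewrite EFinB.
by apply: integrableB => //; exact: finite_measure_integrable_cst.
Qed.

Let integral_center : (\int[L]_x (x - 1)%:E = 0)%E.
Proof.
under eq_integral do rewrite EFinB.
rewrite integralB//; last exact: finite_measure_integrable_cst.
by rewrite L_mean integral_cst//= probability_setT mule1 subee.
Qed.

Let integrable_center_sqr : L.-integrable [set: R] (fun x : R => ((x - 1) ^+ 2)%:E).
Proof.
rewrite (_ : (fun x : R => _) =
    (fun x : R => (x ^+ 2)%:E - x%:E - (x - 1)%:E)%E); last first.
  by apply/funext => x; rewrite -!EFinB; congr EFin; ring.
by apply: integrableB => //; exact: integrableB.
Qed.

Let s : R := fine (\int[L]_x ((x - 1) ^+ 2)%:E).

Let s_ge0 : 0 <= s.
Proof. by apply/fine_ge0/integral_ge0 => x _; rewrite lee_fin sqr_ge0. Qed.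

Let Y i j w : R := V i j w - 1.

Let Y_orthogonal i j k :
  P.-integrable [set: T] (fun w => (Y i j w * Y i k w)%:E) /\
  (\int[P]_w (Y i j w * Y i k w)%:E = (if j == k then s else 0)%:E)%E.
Proof.
have [<-{k}|jk] := eqVneq j k.
  have msq : measurable_fun [set: R] (fun x : R => (x - 1) ^+ 2).
    exact: measurable_funX.
  have := integral_of_law (@V_law i j) msq integrable_center_sqr.
  by rewrite /s fineK// integrable_fin_num.
have tr l := integral_of_law (@V_law i l) mcenter integrable_center.
have := integral_prod_indep (V_indep i jk) mcenter mcenter (tr j).1 (tr k).1.
by rewrite (tr j).2 integral_center mul0e.
Qed.

Let mY i j : measurable_fun [set: T] (Y i j).
Proof. exact: measurable_funB. Qed.

Let row_sqr n w : R := \sum_(i < n) (\sum_(j < n) Y i j w) ^+ 2.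

Let row_sqr_ge0 n w : 0 <= row_sqr n w.
Proof. by apply: sumr_ge0 => i _; exact: sqr_ge0. Qed.

Let mrow_sqr n : measurable_fun [set: T] (row_sqr n).
Proof. by apply: measurable_sum => i; apply: measurable_funX; exact: measurable_sum. Qed.

Let integral_row_sqr n : (\int[P]_w (row_sqr n w)%:E = (n%:R ^+ 2 * s)%:E)%E.
Proof.
under eq_integral do rewrite -sumEFin.
rewrite ge0_integral_sum//; last 2 first.
- by move=> i; apply/measurable_EFinP/measurable_funX; exact: measurable_sum.
- by move=> i w _; rewrite lee_fin sqr_ge0.
under eq_bigr => i _.
  rewrite (integral_sum_sqr_orthogonal (s := s)) => [|j k|j k].
  - over.
  - exact: (Y_orthogonal i j k).1.
  - exact: (Y_orthogonal i j k).2.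
by rewrite sumEFin sumr_const card_ord -[(_ * s) *+ n]mulr_natl mulrA.
Qed.

Let row_dev_sqr_le n w :
  row_dev (fun i j => V i j w) n ^+ 2 <= n%:R * row_sqr n w.
Proof.
apply: le_trans (sqr_sum_le _) _; rewrite ler_wpM2l//.
rewrite le_eqVlt; apply/orP; left; apply/eqP; apply: eq_bigr => i _.
by rewrite real_normK ?num_real// /row_sum sumrB sumr_const card_ord.
Qed.

(** Dividing by n^3 the sum of the squares of the row deviations gives the
    expectation s / n, which is summable along n = (k + 1)^2; by row_dev_sqr_le
    this quotient dominates the square of row_dev / n^2. *)
Lemma ae_row_dev_cvg_squares :
  {ae P, forall w, row_dev (fun i j => symmetrize U i j w) (k.+1 ^ 2)%N /
    ((k.+1 ^ 2)%N%:R ^+ 2) @[k --> \oo] --> (0 : R)}.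
Proof.
pose m k : R := (k.+1 ^ 2)%N%:R.
have m0 k : 0 < m k by rewrite ltr0n expn_gt0.
pose f k w := row_sqr (k.+1 ^ 2)%N w / m k ^+ 3.
have f0 k w : 0 <= f k w by rewrite divr_ge0 ?row_sqr_ge0 ?exprn_ge0// ltW.
have mf k : measurable_fun [set: T] (f k) by exact: measurable_funM.
have fE k : (\int[P]_w (f k w)%:E = (s / k.+1%:R ^+ 2)%:E)%E.
  under eq_integral do rewrite EFinM.
  rewrite ge0_integralZr//; last 3 first.
  - exact/measurable_EFinP.
  - by move=> w _; rewrite lee_fin row_sqr_ge0.
  - by rewrite lee_fin invr_ge0 exprn_ge0// ltW.
  rewrite integral_row_sqr -EFinM -/(m k); congr EFin.
  have := m0 k; rewrite /m natrX => /gt_eqF m0'.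
  by field; rewrite nat1r pnatr_eq0.
have := @ae_cvg0_summable_integral _ _ _ P f mf f0.
under eq_eseriesr do rewrite fE.
move=> /(_ (nneseries_inv_sqr_lty s_ge0)); apply: filterS => w fw.
apply: (@squeeze_cvgr _ _ _ _ (cst 0) (fun k => Num.sqrt (f k w))); last 2 first.
- exact: cvg_cst.
- by rewrite -[X in _ --> X]sqrtr0; exact: continuous_cvg (@sqrt_continuous _ _) fw.
apply: nearW => k; rewrite divr_ge0 ?row_dev_ge0//=.
rewrite -[leLHS]ger0_norm ?divr_ge0 ?row_dev_ge0// -sqrtr_sqr ler_wsqrtr//.
rewrite expr_div_n ler_pdivrMr ?exprn_gt0// -/(m k).
apply: le_trans (row_dev_sqr_le _ _) _.
rewrite /f -/(m k) le_eqVlt; apply/orP; left; apply/eqP.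
by field; rewrite gt_eqF.
Qed.

(** The law gives no mass to the negative half-line, and there are countably
    many entries. *)
Lemma ae_entries_ge0 : {ae P, forall w, forall i j, 0 <= symmetrize U i j w}.
Proof.
apply: ae_foralln => i; apply: ae_foralln => j.
have mI : measurable (`[0, +oo[%classic : set R) by exact: measurable_itv.
exists (V i j @^-1` (~` `[0, +oo[%classic)); split.
- by rewrite -[X in measurable X]setTI; apply: measurable_funP => //; exact: measurableC.
- transitivity (L (~` `[0, +oo[%classic)); first by apply: V_law; exact: measurableC.
  by rewrite probability_setC// L_supp subee.
- by move=> w /= /negP; rewrite in_itv/= andbT => h; exact/negP.
Qed.

End TriangularArray.

Theorem proposition1p5 (R : realType) (d : measure_display)
    (T : measurableType d) (P : probability T R)
    (L : probability R R)
    (U : nat -> nat -> {RV P >-> R})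
    (U_iid : iid_with_law L triangular_indices
               (fun ij : nat * nat => U ij.1 ij.2))
    (L_supp : L `[0, +oo[%classic = 1%E)
    (L_mean : (\int[L]_x x%:E = 1)%E)
    (L_moment2 : (\int[L]_x (x ^+ 2)%:E < +oo)%E) :
  {ae P, forall w,
    (fun n : nat =>
       tv_dist
         (@rho_hat R n (fun i j => symmetrize U i j w))
         (@uniform_weights R n)) @ \oo --> (0 : R)}.
Proof.
have := ae_row_dev_cvg_squares U_iid L_mean L_moment2.
have := ae_entries_ge0 U_iid L_supp.
apply: filterS2 => w U0 sq; apply: tv_dist_cvg.
exact: row_dev_cvg U0 sq.
Qed.
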